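(* Let $\mathcal{B}$ be a bicategory. A horizontal arrow $$\bigl(A_0\xrightarrow{f_1}A_1\xrightarrow{f_2}\cdots\xrightarrow{f_n}A_n;\,i_0,i_1\bigr)$$ in $\mathbf{Dbl}(\mathcal{B})$ (a path of arrows in $\mathcal{B}$ with marked indices $i_0\le i_1$) is a precompanion if and only if the chosen composition $\varphi_{f_{i_0+1},\dots,f_{i_1}}$ is an (internal) equivalence in $\mathcal{B}$.
   Context: In a double category, $\circ$ is horizontal composition, $\cdot$ vertical composition ($\beta\cdot\alpha$ has $\alpha$ on top), $\mathrm{Id}_A$ and $1_A$ are horizontal and vertical identity arrows, $\mathrm{id}_v$ the horizontal identity cell on a vertical arrow $v$, $1_f$ the vertical identity cell on a horizontal arrow $f$. A horizontal arrow $f\colon A\to B$ *is a companion* (has a vertical companion) if there are a vertical arrow $v\colon A\to B$ and cells $\psi$ (top $\mathrm{Id}_A$, bottom $f$, left $1_A$, right $v$) and $\chi$ (top $f$, bottom $\mathrm{Id}_B$, left $v$, right $1_B$) with $\chi\circ\psi=1_f$ and $\chi\cdot\psi=\mathrm{id}_v$. A horizontal arrow $f\colon A\to B$ is a *left precompanion* if there are horizontal arrows $f'\colon A'\to B'$, $r_f\colon B'\to C$ and a vertically invertible double cell with top $f$ and bottom $f'$ such that $r_f\circ f'$ is a companion. It is a *right precompanion* if there are horizontal arrows $f''\colon A''\to B''$, $l_f\colon D\to A''$ and a vertically invertible double cell with top $f$ and bottom $f''$ such that $f''\circ l_f$ is a companion. It is a *precompanion* if it is both. The double category $\mathbf{Dbl}(\mathcal{B})$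 of marked paths: choose a composite $\varphi_{f_1,\dots,f_n}$ (a bracketed composition) of each finite path of composable arrows of $\mathcal{B}$, the empty path at $A$ having composite $1_A$. Objects: paths $A_0\xrightarrow{f_1}\cdots\xrightarrow{f_n}A_n$ with a marked index $i_0$. There is a unique vertical arrow between two objects iff their marked objects $A_{i_0}$, $B_{j_0}$ are equal, and none otherwise. Horizontal arrows: paths with two marked indices $i_0\le i_1$, with domain the path marked at $i_0$ and codomain the path marked at $i_1$; $(i_0,i_1)$ followed by $(i_1,i_2)$ on the same path is $(i_0,i_2)$. A double cell from $(f_1,\dots,f_n;i_0,i_1)$ to $(g_1,\dots,g_m;j_0,j_1)$ exists only if $A_{i_0}=B_{j_0}$ and $A_{i_1}=B_{j_1}$, and is a 2-cell $\varphi_{f_{i_0+1},\dots,f_{i_1}}\Rightarrow\varphi_{g_{j_0+1},\dots,g_{j_1}}$ in $\mathcal{B}$. Vertical composition is that of 2-cells; horizontal composition is horizontal composition of 2-cells in $\mathcal{B}$ conjugated by the canonical associativity/unit coherence isomorphisms between chosen composites. *)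

(* Defs.v *)
From mathcomp Require Import all_boot.
From Stdlib Require Import ProofIrrelevance.

Set Implicit Arguments.
Unset Strict Implicit.
Unset Printing Implicit Defensive.

(* [comp1 g f] is the composite of [f : A -> B] followed by [g : B -> C];
   [comp2 b a] is vertical composition ([a] first), [hcomp2 b a] is horizontal
   composition ([a] on the side of the first 1-cell). *)
Record bicategory := Bicategory {
  ob :> Type;
  hom : ob -> ob -> Type;
  cell2 : forall A B : ob, hom A B -> hom A B -> Type;
  id1 : forall A : ob, hom A A;
  comp1 : forall A B C : ob, hom B C -> hom A B -> hom A C;
  id2 : forall (A B : ob) (f : hom A B), cell2 f f;
  comp2 : forall (A B : ob) (f g h : hom A B),
    cell2 g h -> cell2 f g -> cell2 f h;
  hcomp2 : forall (A B C : ob) (g g' : hom B C) (f f' : hom A B),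
    cell2 g g' -> cell2 f f' -> cell2 (comp1 g f) (comp1 g' f');
  assoc : forall (A B C D : ob) (h : hom C D) (g : hom B C) (f : hom A B),
    cell2 (comp1 (comp1 h g) f) (comp1 h (comp1 g f));
  assocV : forall (A B C D : ob) (h : hom C D) (g : hom B C) (f : hom A B),
    cell2 (comp1 h (comp1 g f)) (comp1 (comp1 h g) f);
  lunit : forall (A B : ob) (f : hom A B), cell2 (comp1 (id1 B) f) f;
  lunitV : forall (A B : ob) (f : hom A B), cell2 f (comp1 (id1 B) f);
  runit : forall (A B : ob) (f : hom A B), cell2 (comp1 f (id1 A)) f;
  runitV : forall (A B : ob) (f : hom A B), cell2 f (comp1 f (id1 A));
  comp2_idl : forall (A B : ob) (f g : hom A B) (a : cell2 f g),
    comp2 (id2 g) a = a;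
  comp2_idr : forall (A B : ob) (f g : hom A B) (a : cell2 f g),
    comp2 a (id2 f) = a;
  comp2A : forall (A B : ob) (f g h k : hom A B)
    (c : cell2 h k) (b : cell2 g h) (a : cell2 f g),
    comp2 c (comp2 b a) = comp2 (comp2 c b) a;
  hcomp2_id : forall (A B C : ob) (g : hom B C) (f : hom A B),
    hcomp2 (id2 g) (id2 f) = id2 (comp1 g f);
  interchange2 : forall (A B C : ob) (g g' g'' : hom B C) (f f' f'' : hom A B)
    (b' : cell2 g' g'') (b : cell2 g g') (a' : cell2 f' f'') (a : cell2 f f'),
    hcomp2 (comp2 b' b) (comp2 a' a) = comp2 (hcomp2 b' a') (hcomp2 b a);
  assoc_nat : forall (A B C D : ob) (h h' : hom C D) (g g' : hom B C)
    (f f' : hom A B) (c : cell2 h h') (b : cell2 g g') (a : cell2 f f'),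
    comp2 (assoc h' g' f') (hcomp2 (hcomp2 c b) a)
    = comp2 (hcomp2 c (hcomp2 b a)) (assoc h g f);
  lunit_nat : forall (A B : ob) (f g : hom A B) (a : cell2 f g),
    comp2 (lunit g) (hcomp2 (id2 (id1 B)) a) = comp2 a (lunit f);
  runit_nat : forall (A B : ob) (f g : hom A B) (a : cell2 f g),
    comp2 (runit g) (hcomp2 a (id2 (id1 A))) = comp2 a (runit f);
  assocK : forall (A B C D : ob) (h : hom C D) (g : hom B C) (f : hom A B),
    comp2 (assocV h g f) (assoc h g f) = id2 _;
  assocVK : forall (A B C D : ob) (h : hom C D) (g : hom B C) (f : hom A B),
    comp2 (assoc h g f) (assocV h g f) = id2 _;
  lunitK : forall (A B : ob) (f : hom A B), comp2 (lunitV f) (lunit f) = id2 _;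
  lunitVK : forall (A B : ob) (f : hom A B), comp2 (lunit f) (lunitV f) = id2 _;
  runitK : forall (A B : ob) (f : hom A B), comp2 (runitV f) (runit f) = id2 _;
  runitVK : forall (A B : ob) (f : hom A B), comp2 (runit f) (runitV f) = id2 _;
  triangle : forall (A B C : ob) (g : hom B C) (f : hom A B),
    comp2 (hcomp2 (id2 g) (lunit f)) (assoc g (id1 B) f)
    = hcomp2 (runit g) (id2 f);
  pentagon : forall (A B C D E : ob) (k : hom D E) (h : hom C D)
    (g : hom B C) (f : hom A B),
    comp2 (assoc k h (comp1 g f)) (assoc (comp1 k h) g f)
    = comp2 (hcomp2 (id2 k) (assoc h g f))
        (comp2 (assoc k (comp1 h g) f) (hcomp2 (assoc k h g) (id2 f)))
}.

Definition invertible2 (B : bicategory) (X Y : B) (f g : hom X Y)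
    (a : cell2 f g) : Prop :=
  exists b : cell2 g f, comp2 b a = id2 f /\ comp2 a b = id2 g.

Definition is_equivalence (B : bicategory) (X Y : B) (f : hom X Y) : Prop :=
  exists (g : hom Y X) (eta : cell2 (id1 X) (comp1 g f))
         (eps : cell2 (comp1 f g) (id1 Y)),
    invertible2 eta /\ invertible2 eps.

(* A cell of [dcell f g v w] has top [f], bottom [g], left [v], right [w];
   [hcomp k h] and [vcomp w v] are "[h] then [k]" and "[v] then [w]";
   [cvcomp b a] has [a] on top, [chcomp b a] has [a] on the left. *)
Record double_data := DoubleData {
  dob :> Type;
  hor : dob -> dob -> Type;
  ver : dob -> dob -> Type;
  dcell : forall A B C D : dob,
    hor A B -> hor C D -> ver A C -> ver B D -> Type;
  hid : forall A : dob, hor A A;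
  hcomp : forall A B C : dob, hor B C -> hor A B -> hor A C;
  vid : forall A : dob, ver A A;
  vcomp : forall A B C : dob, ver B C -> ver A B -> ver A C;
  cvid : forall (A B : dob) (f : hor A B), dcell f f (vid A) (vid B);
  chid : forall (A B : dob) (v : ver A B), dcell (hid A) (hid B) v v;
  cvcomp : forall (A B C D E F : dob)
    (f : hor A B) (g : hor C D) (h : hor E F)
    (v : ver A C) (w : ver B D) (v' : ver C E) (w' : ver D F),
    dcell g h v' w' -> dcell f g v w -> dcell f h (vcomp v' v) (vcomp w' w);
  chcomp : forall (A B C A' B' C' : dob)
    (f : hor A B) (g : hor B C) (f' : hor A' B') (g' : hor B' C')
    (u : ver A A') (v : ver B B') (w : ver C C'),
    dcell g g' v w -> dcell f f' u v -> dcell (hcomp g f) (hcomp g' f') u w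
}.

(* Equality of two cells with the same corners, including equality of their
   boundaries.  Needed because e.g. [hcomp f (hid A)] and [f] are equal but not
   convertible, so that the two sides of a law may have different types. *)
Inductive same_cell (D : double_data) (A B C E : D)
    (f : hor A B) (g : hor C E) (v : ver A C) (w : ver B E)
    (a : dcell f g v w) :
    forall (f' : hor A B) (g' : hor C E) (v' : ver A C) (w' : ver B E),
      dcell f' g' v' w' -> Prop :=
  same_cell_refl : same_cell a a.

Record double_laws (D : double_data) : Prop := DoubleLaws {
  hcomp_idl : forall (A B : D) (f : hor A B), hcomp (hid B) f = f;
  hcomp_idr : forall (A B : D) (f : hor A B), hcomp f (hid A) = f;
  hcompA : forall (A B C E : D) (h : hor C E) (g : hor B C) (f : hor A B),
    hcomp h (hcomp g f) = hcomp (hcomp h g) f;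
  vcomp_idl : forall (A B : D) (v : ver A B), vcomp (vid B) v = v;
  vcomp_idr : forall (A B : D) (v : ver A B), vcomp v (vid A) = v;
  vcompA : forall (A B C E : D) (x : ver C E) (w : ver B C) (v : ver A B),
    vcomp x (vcomp w v) = vcomp (vcomp x w) v;
  cvcomp_idl : forall (A B C E : D) (f : hor A B) (g : hor C E)
    (v : ver A C) (w : ver B E) (a : dcell f g v w),
    same_cell (cvcomp (cvid g) a) a;
  cvcomp_idr : forall (A B C E : D) (f : hor A B) (g : hor C E)
    (v : ver A C) (w : ver B E) (a : dcell f g v w),
    same_cell (cvcomp a (cvid f)) a;
  cvcompA : forall (A0 B0 A1 B1 A2 B2 A3 B3 : D)
    (f0 : hor A0 B0) (f1 : hor A1 B1) (f2 : hor A2 B2) (f3 : hor A3 B3)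
    (v1 : ver A0 A1) (w1 : ver B0 B1) (v2 : ver A1 A2) (w2 : ver B1 B2)
    (v3 : ver A2 A3) (w3 : ver B2 B3)
    (c : dcell f2 f3 v3 w3) (b : dcell f1 f2 v2 w2) (a : dcell f0 f1 v1 w1),
    same_cell (cvcomp c (cvcomp b a)) (cvcomp (cvcomp c b) a);
  chcomp_idl : forall (A B C E : D) (f : hor A B) (g : hor C E)
    (v : ver A C) (w : ver B E) (a : dcell f g v w),
    same_cell (chcomp (chid w) a) a;
  chcomp_idr : forall (A B C E : D) (f : hor A B) (g : hor C E)
    (v : ver A C) (w : ver B E) (a : dcell f g v w),
    same_cell (chcomp a (chid v)) a;
  chcompA : forall (A0 A1 A2 A3 B0 B1 B2 B3 : D)
    (f1 : hor A0 A1) (f2 : hor A1 A2) (f3 : hor A2 A3)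
    (g1 : hor B0 B1) (g2 : hor B1 B2) (g3 : hor B2 B3)
    (v0 : ver A0 B0) (v1 : ver A1 B1) (v2 : ver A2 B2) (v3 : ver A3 B3)
    (c : dcell f3 g3 v2 v3) (b : dcell f2 g2 v1 v2) (a : dcell f1 g1 v0 v1),
    same_cell (chcomp c (chcomp b a)) (chcomp (chcomp c b) a);
  cvid_hid : forall A : D, cvid (hid A) = chid (vid A);
  cvid_hcomp : forall (A B C : D) (g : hor B C) (f : hor A B),
    cvid (hcomp g f) = chcomp (cvid g) (cvid f);
  chid_vcomp : forall (A B C : D) (w : ver B C) (v : ver A B),
    chid (vcomp w v) = cvcomp (chid w) (chid v);
  interchange : forall (A0 B0 C0 A1 B1 C1 A2 B2 C2 : D)
    (f0 : hor A0 B0) (g0 : hor B0 C0) (f1 : hor A1 B1) (g1 : hor B1 C1)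
    (f2 : hor A2 B2) (g2 : hor B2 C2)
    (u1 : ver A0 A1) (v1 : ver B0 B1) (w1 : ver C0 C1)
    (u2 : ver A1 A2) (v2 : ver B1 B2) (w2 : ver C1 C2)
    (d : dcell g1 g2 v2 w2) (c : dcell f1 f2 u2 v2)
    (b : dcell g0 g1 v1 w1) (a : dcell f0 f1 u1 v1),
    cvcomp (chcomp d c) (chcomp b a) = chcomp (cvcomp d b) (cvcomp c a)
}.

Record double_category := DoubleCategory {
  double_of :> double_data;
  double_lawsP : double_laws double_of
}.

Definition is_companion (D : double_category) (A B : D) (f : hor A B) : Prop :=
  exists (v : ver A B)
         (psi : dcell (hid A) f (vid A) v) (chi : dcell f (hid B) v (vid B)),
    same_cell (chcomp chi psi) (cvid f) /\ same_cell (cvcomp chi psi) (chid v).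

Definition vinvertible (D : double_category) (A B C E : D)
    (f : hor A B) (g : hor C E) (v : ver A C) (w : ver B E)
    (a : dcell f g v w) : Prop :=
  exists (v' : ver C A) (w' : ver E B) (b : dcell g f v' w'),
    same_cell (cvcomp b a) (cvid f) /\ same_cell (cvcomp a b) (cvid g).

Definition left_precompanion (D : double_category) (A B : D) (f : hor A B) :
    Prop :=
  exists (A' B' C : D) (f' : hor A' B') (r : hor B' C)
         (v : ver A A') (w : ver B B') (a : dcell f f' v w),
    vinvertible a /\ is_companion (hcomp r f').

Definition right_precompanion (D : double_category) (A B : D) (f : hor A B) :
    Prop :=
  exists (A' B' C : D) (f' : hor A' B') (l : hor C A')
         (v : ver A A') (w : ver B B') (a : dcell f f' v w),
    vinvertible a /\ is_companion (hcomp f' l).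

Definition precompanion (D : double_category) (A B : D) (f : hor A B) : Prop :=
  left_precompanion f /\ right_precompanion f.

Inductive bipath (B : bicategory) : B -> B -> Type :=
| pnil (X : B) : bipath X X
| pcons (X Y Z : B) (f : hom X Y) (p : bipath Y Z) : bipath X Z.

Fixpoint plen (B : bicategory) (X Y : B) (p : bipath X Y) : nat :=
  if p is pcons _ _ _ _ p' then (plen p').+1 else 0.

(* [vertex p i] is the i-th object of [p] for [i <= plen p] (and the last
   object for larger [i]). *)
Fixpoint vertex (B : bicategory) (X Y : B) (p : bipath X Y) (i : nat) : B :=
  match p with
  | pnil X => X
  | pcons X _ _ _ p' => if i is i'.+1 then vertex p' i' else X
  end.

Fixpoint pcat (B : bicategory) (X Y Z : B) (p : bipath X Y) :
    bipath Y Z -> bipath X Z :=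
  match p in bipath X Y return bipath Y Z -> bipath X Z with
  | pnil _ => id
  | pcons _ _ _ f p' => fun q => pcons f (pcat p' q)
  end.

Fixpoint ptake (B : bicategory) (X Y : B) (p : bipath X Y) (j : nat) :
    bipath X (vertex p j) :=
  match p in bipath X Y return bipath X (vertex p j) with
  | pnil X => pnil X
  | pcons X _ _ f p' =>
    match j return bipath X (vertex (pcons f p') j) with
    | 0 => pnil X
    | j'.+1 => pcons f (ptake p' j')
    end
  end.

(* The subpath of [p] from index [i] to index [j], i.e. f_(i+1), ..., f_j. *)
Fixpoint seg (B : bicategory) (X Y : B) (p : bipath X Y) (i j : nat) :
    i <= j -> bipath (vertex p i) (vertex p j) :=
  match p in bipath X Y return i <= j -> bipath (vertex p i) (vertex p j) with
  | pnil X => fun=> pnil X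
  | pcons X _ _ f p' =>
    match i, j return
      i <= j -> bipath (vertex (pcons f p') i) (vertex (pcons f p') j) with
    | 0, j' => fun=> ptake (pcons f p') j'
    | _.+1, 0 => fun h => False_rect _ (notF h)
    | i'.+1, j'.+1 => seg p' (i := i') (j := j')
    end
  end.

Arguments seg {B X Y} p {i j}.

(* There is no constructor for the empty path: bracketings do not insert identity
   1-cells, and the empty path is treated separately in [composite]. *)
Inductive bracketing (B : bicategory) : forall X Y : B, bipath X Y -> Type :=
| br_arrow (X Y : B) (f : hom X Y) : bracketing (pcons f (pnil Y))
| br_comp (X Y Z : B) (p : bipath X Y) (q : bipath Y Z) :
    bracketing p -> bracketing q -> bracketing (pcat p q).

Fixpoint br_eval (B : bicategory) (X Y : B) (p : bipath X Y)
    (b : bracketing p) : hom X Y :=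
  match b with
  | br_arrow _ _ f => f
  | br_comp _ _ _ _ _ b1 b2 => comp1 (br_eval b2) (br_eval b1)
  end.

Definition composite_choice (B : bicategory) : Type :=
  forall (X Y Z : B) (f : hom X Y) (p : bipath Y Z), bracketing (pcons f p).

Definition composite (B : bicategory) (phi : composite_choice B)
    (X Y : B) (p : bipath X Y) : hom X Y :=
  match p with
  | pnil X => id1 X
  | pcons _ _ _ f p' => br_eval (phi _ _ _ f p')
  end.

Record iso2 (B : bicategory) (X Y : B) (f g : hom X Y) := Iso2 {
  fwd :> cell2 f g;
  bwd : cell2 g f;
  fwdK : comp2 bwd fwd = id2 f;
  bwdK : comp2 fwd bwd = id2 g
}.

Definition iso2_id (B : bicategory) (X Y : B) (f : hom X Y) : iso2 f f :=
  Iso2 (comp2_idl (id2 f)) (comp2_idl (id2 f)).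

Definition iso2_inv (B : bicategory) (X Y : B) (f g : hom X Y) (a : iso2 f g) :
    iso2 g f := Iso2 (bwdK a) (fwdK a).

Lemma iso2_comp_subproof (B : bicategory) (X Y : B) (f g h : hom X Y)
  (b : iso2 g h) (a : iso2 f g) :
  comp2 (comp2 (bwd a) (bwd b)) (comp2 b a) = id2 f.
Proof. by rewrite comp2A -(comp2A (bwd a)) fwdK comp2_idr fwdK. Qed.

Definition iso2_comp (B : bicategory) (X Y : B) (f g h : hom X Y)
    (b : iso2 g h) (a : iso2 f g) : iso2 f h :=
  Iso2 (iso2_comp_subproof b a)
       (iso2_comp_subproof (iso2_inv a) (iso2_inv b)).

Lemma iso2_hcomp_subproof (B : bicategory) (X Y Z : B)
  (g g' : hom Y Z) (f f' : hom X Y) (b : iso2 g g') (a : iso2 f f') :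
  comp2 (hcomp2 (bwd b) (bwd a)) (hcomp2 b a) = id2 _.
Proof. by rewrite -interchange2 !fwdK hcomp2_id. Qed.

Definition iso2_hcomp (B : bicategory) (X Y Z : B)
    (g g' : hom Y Z) (f f' : hom X Y) (b : iso2 g g') (a : iso2 f f') :
    iso2 (comp1 g f) (comp1 g' f') :=
  Iso2 (iso2_hcomp_subproof b a)
       (iso2_hcomp_subproof (iso2_inv b) (iso2_inv a)).

Definition assoc_iso (B : bicategory) (X Y Z T : B)
    (h : hom Z T) (g : hom Y Z) (f : hom X Y) :
    iso2 (comp1 (comp1 h g) f) (comp1 h (comp1 g f)) :=
  Iso2 (assocK h g f) (assocVK h g f).

Definition lunit_iso (B : bicategory) (X Y : B) (f : hom X Y) :
    iso2 (comp1 (id1 Y) f) f := Iso2 (lunitK f) (lunitVK f).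

Definition runit_iso (B : bicategory) (X Y : B) (f : hom X Y) :
    iso2 (comp1 f (id1 X)) f := Iso2 (runitK f) (runitVK f).

(* The standard composite ((1 o f_n) o ...) o f_1, used to compare bracketings;
   by coherence, comparison through it gives the canonical isomorphism. *)
Fixpoint norm (B : bicategory) (X Y : B) (p : bipath X Y) : hom X Y :=
  match p with
  | pnil X => id1 X
  | pcons _ _ _ f p' => comp1 (norm p') f
  end.

Fixpoint norm_cat (B : bicategory) (X Y Z : B) (p : bipath X Y) :
    forall q : bipath Y Z, iso2 (comp1 (norm q) (norm p)) (norm (pcat p q)) :=
  match p in bipath X Y return
    forall q : bipath Y Z, iso2 (comp1 (norm q) (norm p)) (norm (pcat p q)) with
  | pnil _ => fun q => runit_iso (norm q)
  | pcons _ _ _ f p' => fun q =>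
      iso2_comp (iso2_hcomp (norm_cat p' q) (iso2_id f))
                (iso2_inv (assoc_iso (norm q) (norm p') f))
  end.

Fixpoint br_norm (B : bicategory) (X Y : B) (p : bipath X Y)
    (b : bracketing p) : iso2 (br_eval b) (norm p) :=
  match b in @bracketing _ _ _ p return iso2 (br_eval b) (norm p) with
  | br_arrow _ _ f => iso2_inv (lunit_iso f)
  | br_comp _ _ _ p q b1 b2 =>
      iso2_comp (norm_cat p q) (iso2_hcomp (br_norm b2) (br_norm b1))
  end.

Definition composite_norm (B : bicategory) (phi : composite_choice B)
    (X Y : B) (p : bipath X Y) : iso2 (composite phi p) (norm p) :=
  match p in bipath X Y return iso2 (composite phi p) (norm p) with
  | pnil X => iso2_id (id1 X)
  | pcons _ _ _ f p' => br_norm (phi _ _ _ f p')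
  end.

Definition composite_cat (B : bicategory) (phi : composite_choice B)
    (X Y Z : B) (p : bipath X Y) (q : bipath Y Z) :
    iso2 (comp1 (composite phi q) (composite phi p))
         (composite phi (pcat p q)) :=
  iso2_comp (iso2_inv (composite_norm phi (pcat p q)))
    (iso2_comp (norm_cat p q)
       (iso2_hcomp (composite_norm phi q) (composite_norm phi p))).

Definition composite_eq (B : bicategory) (phi : composite_choice B)
    (X Y : B) (p q : bipath X Y) (e : p = q) :
    iso2 (composite phi p) (composite phi q) :=
  match e in _ = q return iso2 (composite phi p) (composite phi q) with
  | erefl => iso2_id (composite phi p)
  end.

Definition cast1 (B : bicategory) (X X' Y Y' : B) (v : X = X') (w : Y = Y')
    (f : hom X Y) : hom X' Y' :=
  match v in _ = X', w in _ = Y' return hom X' Y' with erefl, erefl => f end.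

Definition cast2 (B : bicategory) (X X' Y Y' : B) (v : X = X') (w : Y = Y')
    (f g : hom X Y) (a : cell2 f g) : cell2 (cast1 v w f) (cast1 v w g) :=
  match v as v, w as w return cell2 (cast1 v w f) (cast1 v w g) with
  | erefl, erefl => a
  end.

Definition over (B : bicategory) (X X' Y Y' : B) (v : X = X') (w : Y = Y')
    (f : hom X Y) (g : hom X' Y') : Type := cell2 (cast1 v w f) g.

Definition over_pre (B : bicategory) (X X' Y Y' : B) (v : X = X') (w : Y = Y')
    (f0 f : hom X Y) (g : hom X' Y') (a : over v w f g) (c : cell2 f0 f) :
    over v w f0 g := comp2 a (cast2 v w c).

Definition over_post (B : bicategory) (X X' Y Y' : B) (v : X = X')
    (w : Y = Y') (f : hom X Y) (g g' : hom X' Y') (c : cell2 g g')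
    (a : over v w f g) : over v w f g' := comp2 c a.

Definition over_id1 (B : bicategory) (X X' : B) (v : X = X') :
    over v v (id1 X) (id1 X') :=
  match v in _ = X' return over v v (id1 X) (id1 X') with
  | erefl => id2 (id1 X)
  end.

Definition over_vcomp (B : bicategory) (X X' X'' Y Y' Y'' : B)
    (v : X = X') (w : Y = Y') (v' : X' = X'') (w' : Y' = Y'')
    (f : hom X Y) (g : hom X' Y') (h : hom X'' Y'')
    (b : over v' w' g h) (a : over v w f g) :
    over (etrans v v') (etrans w w') f h :=
  match v' as v' in _ = X'', w' as w' in _ = Y'' return
    forall h : hom X'' Y'', over v' w' g h ->
      over (etrans v v') (etrans w w') f h with
  | erefl, erefl => fun _ b => comp2 b a
  end h b.

Definition over_hcomp (B : bicategory) (X X' Y Y' Z Z' : B)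
    (u : X = X') (v : Y = Y') (w : Z = Z')
    (f : hom X Y) (g : hom Y Z) (f' : hom X' Y') (g' : hom Y' Z')
    (b : over v w g g') (a : over u v f f') :
    over u w (comp1 g f) (comp1 g' f') :=
  match u as u in _ = X', v as v in _ = Y', w as w in _ = Z' return
    forall (f' : hom X' Y') (g' : hom Y' Z'),
      over v w g g' -> over u v f f' ->
      over u w (comp1 g f) (comp1 g' f') with
  | erefl, erefl, erefl => fun _ _ b a => hcomp2 b a
  end f' g' b a.

Record bpath (B : bicategory) := BPath {
  psrc : B;
  ptgt : B;
  arrows :> bipath psrc ptgt
}.

Record marked_path (B : bicategory) := MarkedPath {
  mpath : bpath B;
  mindex : 'I_(plen mpath).+1
}.

Definition marked (B : bicategory) (X Y : B) (p : bipath X Y)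
    (i : 'I_(plen p).+1) : marked_path B := @MarkedPath B (BPath p) i.

Arguments marked {B X Y} p i.

Definition mark (B : bicategory) (P : marked_path B) : B :=
  vertex (mpath P) (mindex P).

(* A path with marked indices i0 <= i1 is a horizontal arrow from the path
   marked at i0 to the path marked at i1; so there is one horizontal arrow from
   [P] to [Q] if [P] and [Q] are markings i0 <= i1 of the same path, and none
   otherwise. *)
Record dbl_hor (B : bicategory) (P Q : marked_path B) : Prop := DblHor {
  hor_mpath : mpath P = mpath Q;
  hor_index : mindex P <= mindex Q
}.

Definition dbl_arrow (B : bicategory) (X Y : B) (p : bipath X Y)
    (i0 i1 : 'I_(plen p).+1) (h : i0 <= i1) :
    dbl_hor (marked p i0) (marked p i1) :=
  @DblHor B (marked p i0) (marked p i1) erefl h.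

Definition dbl_ver (B : bicategory) (P Q : marked_path B) : Prop :=
  mark P = mark Q.

Definition dbl_seg (B : bicategory) (P Q : marked_path B) (h : dbl_hor P Q) :
    bipath (mark P) (mark Q) :=
  match hor_mpath h in _ = q return forall j : 'I_(plen q).+1,
    mindex P <= j -> bipath (mark P) (vertex q j) with
  | erefl => fun j le_ij => seg (mpath P) le_ij
  end (mindex Q) (hor_index h).

Definition dbl_hid (B : bicategory) (P : marked_path B) : dbl_hor P P :=
  DblHor erefl (leqnn (mindex P)).

Definition dbl_hcomp (B : bicategory) (P Q R : marked_path B)
    (k : dbl_hor Q R) (h : dbl_hor P Q) : dbl_hor P R :=
  DblHor (etrans (hor_mpath h) (hor_mpath k)) (leq_trans (hor_index h) (hor_index k)).

Lemma seg_id (B : bicategory) (X Y : B) (p : bipath X Y) (i : nat) (h : i <= i) :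
  seg p h = pnil (vertex p i).
Proof. by elim: p i h => [Z|Z T U f p IH] [|i] h /=. Qed.

Lemma seg_take (B : bicategory) (X Y : B) (p : bipath X Y) (j k : nat)
  (h : j <= k) : ptake p k = pcat (ptake p j) (seg p h).
Proof.
elim: p j k h => [Z|Z T U f p IH] [|j] [|k] h //=.
by rewrite (IH j k h).
Qed.

Lemma seg_cat (B : bicategory) (X Y : B) (p : bipath X Y) (i j k : nat)
  (hij : i <= j) (hjk : j <= k) (hik : i <= k) :
  seg p hik = pcat (seg p hij) (seg p hjk).
Proof.
elim: p i j k hij hjk hik => [Z|Z T U f p IH] [|i] [|j] [|k] hij hjk hik //=.
exact: (seg_take (pcons f p) hjk).
Qed.

Lemma dbl_seg_id (B : bicategory) (P : marked_path B) :
  dbl_seg (dbl_hid P) = pnil (mark P).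
Proof. exact: (seg_id (arrows (mpath P)) (leqnn (mindex P))). Qed.

Lemma dbl_seg_cat (B : bicategory) (P Q R : marked_path B)
  (k : dbl_hor Q R) (h : dbl_hor P Q) :
  dbl_seg (dbl_hcomp k h) = pcat (dbl_seg h) (dbl_seg k).
Proof.
case: P Q R h k => [p i] [q j] [r l] [/= e hij] [/= e' hjl].
case: r / e' l hjl => l hjl; case: q / e j l hij hjl => j l hij hjl.
exact: seg_cat.
Qed.

Definition dbl_cell (B : bicategory) (phi : composite_choice B)
    (P Q P' Q' : marked_path B) (h : dbl_hor P Q) (k : dbl_hor P' Q')
    (v : dbl_ver P P') (w : dbl_ver Q Q') : Type :=
  over v w (composite phi (dbl_seg h)) (composite phi (dbl_seg k)).

Definition dbl_chid (B : bicategory) (phi : composite_choice B)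
    (P Q : marked_path B) (v : dbl_ver P Q) :
    dbl_cell phi (dbl_hid P) (dbl_hid Q) v v :=
  over_post (bwd (composite_eq phi (dbl_seg_id Q)))
    (over_pre (over_id1 v) (composite_eq phi (dbl_seg_id P))).

(* Horizontal composition of 2-cells along factorisations [r = p1 ++ p2] and
   [s = q1 ++ q2], conjugated by the canonical isomorphisms. *)
Definition composite_hcomp (B : bicategory) (phi : composite_choice B)
    (X Y Z X' Y' Z' : B) (u : X = X') (v : Y = Y') (w : Z = Z')
    (p1 : bipath X Y) (p2 : bipath Y Z) (r : bipath X Z) (e : r = pcat p1 p2)
    (q1 : bipath X' Y') (q2 : bipath Y' Z') (s : bipath X' Z') (e' : s = pcat q1 q2)
    (b : over v w (composite phi p2) (composite phi q2))
    (a : over u v (composite phi p1) (composite phi q1)) :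
    over u w (composite phi r) (composite phi s) :=
  over_post
    (comp2 (bwd (composite_eq phi e')) (composite_cat phi q1 q2))
    (over_pre (over_hcomp b a)
      (comp2 (bwd (composite_cat phi p1 p2)) (composite_eq phi e))).

Definition dbl_data (B : bicategory) (phi : composite_choice B) : double_data :=
  @DoubleData (marked_path B) (@dbl_hor B) (@dbl_ver B) (@dbl_cell B phi)
    (@dbl_hid B) (@dbl_hcomp B)
    (fun P => erefl (mark P)) (fun P Q R w v => etrans v w)
    (fun P Q h => id2 (composite phi (dbl_seg h)))
    (@dbl_chid B phi)
    (fun _ _ _ _ _ _ _ _ _ _ _ _ _ b a => over_vcomp b a)
    (fun _ _ _ _ _ _ f g f' g' _ _ _ b a =>
       composite_hcomp (dbl_seg_cat g f) (dbl_seg_cat g' f') b a).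

Lemma iso2_cancelL (B : bicategory) (X Y : B) (f g h : hom X Y)
  (i : iso2 g h) (a b : cell2 f g) : comp2 i a = comp2 i b -> a = b.
Proof.
by move/(congr1 (comp2 (bwd i))); rewrite !comp2A fwdK !comp2_idl.
Qed.

Lemma iso2_cancelR (B : bicategory) (X Y : B) (f g h : hom X Y)
  (i : iso2 f g) (a b : cell2 g h) : comp2 a i = comp2 b i -> a = b.
Proof.
by move/(congr1 (fun x => comp2 x (bwd i))); rewrite -!comp2A bwdK !comp2_idr.
Qed.

Lemma hcomp2_id1_inj (B : bicategory) (X Y : B) (f g : hom X Y)
  (a b : cell2 f g) :
  hcomp2 (id2 (id1 Y)) a = hcomp2 (id2 (id1 Y)) b -> a = b.
Proof.
move/(congr1 (comp2 (lunit g))); rewrite !lunit_nat.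
exact: (@iso2_cancelR _ _ _ _ _ _ (lunit_iso f)).
Qed.

Lemma hcomp2_1id_inj (B : bicategory) (X Y : B) (f g : hom X Y)
  (a b : cell2 f g) :
  hcomp2 a (id2 (id1 X)) = hcomp2 b (id2 (id1 X)) -> a = b.
Proof.
move/(congr1 (comp2 (runit g))); rewrite !runit_nat.
exact: (@iso2_cancelR _ _ _ _ _ _ (runit_iso f)).
Qed.

Lemma hcomp2_compl (B : bicategory) (X Y Z : B) (g : hom Y Z)
  (f f' f'' : hom X Y) (b : cell2 f' f'') (a : cell2 f f') :
  hcomp2 (id2 g) (comp2 b a) = comp2 (hcomp2 (id2 g) b) (hcomp2 (id2 g) a).
Proof. by rewrite -interchange2 comp2_idl. Qed.

Lemma hcomp2_compr (B : bicategory) (X Y Z : B) (g g' g'' : hom Y Z)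
  (f : hom X Y) (b : cell2 g' g'') (a : cell2 g g') :
  hcomp2 (comp2 b a) (id2 f) = comp2 (hcomp2 b (id2 f)) (hcomp2 a (id2 f)).
Proof. by rewrite -interchange2 comp2_idl. Qed.

Lemma lunit_comp1 (B : bicategory) (X Y Z : B) (g : hom Y Z) (f : hom X Y) :
  comp2 (lunit (comp1 g f)) (assoc (id1 Z) g f) = hcomp2 (lunit g) (id2 f).
Proof.
apply: hcomp2_id1_inj; rewrite hcomp2_compl.
apply: (@iso2_cancelR _ _ _ _ _ _
  (iso2_comp (assoc_iso _ _ _) (iso2_hcomp (assoc_iso _ _ _) (iso2_id f)))).
rewrite /= -!comp2A -pentagon !comp2A triangle.
rewrite -(hcomp2_id g f) -!assoc_nat -(comp2A (assoc _ g f)) -interchange2.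
by rewrite triangle comp2_idl.
Qed.

Lemma runit_comp1 (B : bicategory) (X Y Z : B) (g : hom Y Z) (f : hom X Y) :
  comp2 (hcomp2 (id2 g) (runit f)) (assoc g f (id1 X)) = runit (comp1 g f).
Proof.
apply: hcomp2_1id_inj; rewrite hcomp2_compr.
apply: (@iso2_cancelL _ _ _ _ _ _ (assoc_iso _ _ _)) => /=.
rewrite -triangle !comp2A.
rewrite -(hcomp2_id g f) !assoc_nat -!comp2A pentagon !comp2A.
by rewrite -hcomp2_compl triangle.
Qed.

Lemma lunit_runit (B : bicategory) (X : B) : lunit (id1 X) = runit (id1 X).
Proof.
apply: hcomp2_1id_inj; rewrite -triangle -lunit_comp1; congr comp2.
apply: (@iso2_cancelL _ _ _ _ _ _ (lunit_iso _)) => /=.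
by rewrite -lunit_nat.
Qed.

Lemma assocV_nat (B : bicategory) (X Y Z T : B) (h h' : hom Z T)
  (g g' : hom Y Z) (f f' : hom X Y)
  (c : cell2 h h') (b : cell2 g g') (a : cell2 f f') :
  comp2 (assocV h' g' f') (hcomp2 c (hcomp2 b a))
  = comp2 (hcomp2 (hcomp2 c b) a) (assocV h g f).
Proof.
apply: (@iso2_cancelL _ _ _ _ _ _ (assoc_iso _ _ _)) => /=.
apply: (@iso2_cancelR _ _ _ _ _ _ (assoc_iso _ _ _)) => /=.
by rewrite !comp2A assocVK comp2_idl -!comp2A assocK comp2_idr assoc_nat.
Qed.

Lemma pentagonV (B : bicategory) (X Y Z T U : B) (k : hom T U) (h : hom Z T)
  (g : hom Y Z) (f : hom X Y) :
  comp2 (hcomp2 (assoc k h g) (id2 f)) (assocV (comp1 k h) g f)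
  = comp2 (assocV k (comp1 h g) f)
      (comp2 (hcomp2 (id2 k) (assocV h g f)) (assoc k h (comp1 g f))).
Proof.
apply: (@iso2_cancelL _ _ _ _ _ _ (assoc_iso _ _ _)) => /=.
apply: (@iso2_cancelL _ _ _ _ _ _
  (iso2_hcomp (iso2_id k) (assoc_iso _ _ _))) => /=.
apply: (@iso2_cancelR _ _ _ _ _ _ (assoc_iso _ _ _)) => /=.
rewrite -!comp2A assocK comp2_idr -pentagon.
rewrite !comp2A -(comp2A _ (assoc k _ f)) assocVK comp2_idr.
by rewrite -hcomp2_compl assocVK hcomp2_id comp2_idl.
Qed.

Lemma pcat0 (B : bicategory) (X Y : B) (p : bipath X Y) : pcat p (pnil Y) = p.
Proof. by elim: p => //= Z T U f p ->. Qed.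

Lemma pcatA (B : bicategory) (X Y Z T : B) (p : bipath X Y) (q : bipath Y Z)
  (r : bipath Z T) : pcat p (pcat q r) = pcat (pcat p q) r.
Proof. by elim: p q => //= U V W f p IH q; rewrite IH. Qed.

Definition norm_eq (B : bicategory) (X Y : B) (p q : bipath X Y) (e : p = q) :
    cell2 (norm p) (norm q) :=
  match e in _ = q return cell2 (norm p) (norm q) with
  | erefl => id2 (norm p)
  end.

Lemma norm_eq_id (B : bicategory) (X Y : B) (p : bipath X Y) (e : p = p) :
  norm_eq e = id2 (norm p).
Proof. by rewrite (proof_irrelevance _ e erefl). Qed.

Lemma norm_eq_cons (B : bicategory) (X Y Z : B) (f : hom X Y)
  (p q : bipath Y Z) (e : p = q) (e' : pcons f p = pcons f q) :
  norm_eq e' = hcomp2 (norm_eq e) (id2 f).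
Proof. by case: q / e e' => e'; rewrite norm_eq_id hcomp2_id. Qed.

Lemma norm_cat0 (B : bicategory) (X Y : B) (p : bipath X Y)
  (e : pcat p (pnil Y) = p) :
  comp2 (norm_eq e) (norm_cat p (pnil Y)) = lunit (norm p).
Proof.
elim: p e => [Z|Z T U f p IH] e /=.
  by rewrite norm_eq_id comp2_idl lunit_runit.
rewrite (norm_eq_cons (pcat0 p)) !comp2A -hcomp2_compr IH.
by rewrite -lunit_comp1 -comp2A assocVK comp2_idr.
Qed.

Lemma norm_catA (B : bicategory) (X Y Z T : B) (p : bipath X Y) (q : bipath Y Z)
  (r : bipath Z T) (e : pcat p (pcat q r) = pcat (pcat p q) r) :
  comp2 (norm_eq e)
    (comp2 (norm_cat p (pcat q r)) (hcomp2 (norm_cat q r) (id2 (norm p))))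
  = comp2 (norm_cat (pcat p q) r)
      (comp2 (hcomp2 (id2 (norm r)) (norm_cat p q))
         (assoc (norm r) (norm q) (norm p))).
Proof.
elim: p q e => [U|U V W f p IH] q e /=.
  by rewrite norm_eq_id comp2_idl runit_comp1 runit_nat.
rewrite (norm_eq_cons (pcatA p q r)) -(hcomp2_id (norm p)).
rewrite -!comp2A assocV_nat hcomp2_compl -!comp2A.
rewrite !(comp2A (assocV _ _ _)) assocV_nat -!comp2A -pentagonV !comp2A.
by rewrite -!hcomp2_compr -!comp2A IH.
Qed.

Lemma composite_eq_id (B : bicategory) (phi : composite_choice B) (X Y : B)
  (p : bipath X Y) (e : p = p) : composite_eq phi e = iso2_id _.
Proof. by rewrite (proof_irrelevance _ e erefl). Qed.

Lemma composite_norm_eq (B : bicategory) (phi : composite_choice B) (X Y : B)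
  (p q : bipath X Y) (e : p = q) :
  comp2 (composite_norm phi q) (composite_eq phi e)
  = comp2 (norm_eq e) (composite_norm phi p).
Proof. by case: q / e; rewrite /= comp2_idl comp2_idr. Qed.

Lemma composite_norm_cat (B : bicategory) (phi : composite_choice B)
  (X Y Z : B) (p : bipath X Y) (q : bipath Y Z) :
  comp2 (composite_norm phi (pcat p q)) (composite_cat phi p q)
  = comp2 (norm_cat p q)
      (hcomp2 (composite_norm phi q) (composite_norm phi p)).
Proof. by rewrite /= comp2A bwdK comp2_idl. Qed.

Lemma composite_cat0p (B : bicategory) (phi : composite_choice B) (X Y : B)
  (p : bipath X Y) : fwd (composite_cat phi (pnil X) p) = runit (composite phi p).
Proof.
apply: (iso2_cancelL (i := composite_norm phi p)).
by rewrite (composite_norm_cat phi (pnil X) p) /= runit_nat.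
Qed.

Lemma composite_catp0 (B : bicategory) (phi : composite_choice B) (X Y : B)
  (p : bipath X Y) (e : pcat p (pnil Y) = p) :
  comp2 (composite_eq phi e) (composite_cat phi p (pnil Y))
  = lunit (composite phi p).
Proof.
apply: (iso2_cancelL (i := composite_norm phi p)).
rewrite comp2A composite_norm_eq -comp2A composite_norm_cat comp2A norm_cat0.
by rewrite lunit_nat.
Qed.

Lemma composite_catA (B : bicategory) (phi : composite_choice B)
  (X Y Z T : B) (p : bipath X Y) (q : bipath Y Z) (r : bipath Z T)
  (e : pcat p (pcat q r) = pcat (pcat p q) r) :
  comp2 (composite_eq phi e)
    (comp2 (composite_cat phi p (pcat q r))
       (hcomp2 (composite_cat phi q r) (id2 (composite phi p))))
  = comp2 (composite_cat phi (pcat p q) r)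
      (comp2 (hcomp2 (id2 (composite phi r)) (composite_cat phi p q))
         (assoc (composite phi r) (composite phi q) (composite phi p))).
Proof.
apply: (iso2_cancelL (i := composite_norm phi _)).
move: (composite_norm_eq phi e) (norm_catA e).
move: (composite_norm_cat phi p (pcat q r)) (composite_norm_cat phi q r).
move: (composite_norm_cat phi (pcat p q) r) (composite_norm_cat phi p q).
move: (composite_eq phi e) (norm_eq e).
move: (composite_cat phi p (pcat q r)) (composite_cat phi q r).
move: (composite_cat phi (pcat p q) r) (composite_cat phi p q).
move: (norm_cat p (pcat q r)) (norm_cat q r).
move: (norm_cat (pcat p q) r) (norm_cat p q).
move: (composite_norm phi (pcat p (pcat q r))).
move: (composite_norm phi (pcat (pcat p q) r)).
move: (composite_norm phi (pcat p q)) (composite_norm phi (pcat q r)).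
move: (composite_norm phi p) (composite_norm phi q) (composite_norm phi r).
move=> cp cq cr cpq cqr cpqr' cpqr Npqr' Npq Npqr Nqr Jpqr' Jpq Jpqr Jqr E E'.
move=> HJpqr' HJpq HJpqr HJqr HE HN.
rewrite !comp2A HE -(comp2A _ cpqr) HJpqr HJpqr'.
rewrite -!comp2A !(comp2A (hcomp2 _ _) (hcomp2 _ _)) -!interchange2 !comp2_idr.
rewrite HJpq HJqr -{2}(comp2_idl cr) -{1}(comp2_idl cp) !interchange2.
by rewrite -!comp2A -assoc_nat !comp2A -(comp2A E') HN -!comp2A.
Qed.

Definition over_cast (B : bicategory) (X X' Y Y' : B) (v v' : X = X')
    (w w' : Y = Y') (ev : v = v') (ew : w = w') (f : hom X Y) (g : hom X' Y')
    (a : over v w f g) : over v' w' f g :=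
  match ev in _ = v', ew in _ = w' return over v' w' f g with
  | erefl, erefl => a
  end.

Definition same_over (B : bicategory) (phi : composite_choice B)
    (X X' Y Y' : B) (v v' : X = X') (w w' : Y = Y')
    (p p' : bipath X Y) (q q' : bipath X' Y')
    (a : over v w (composite phi p) (composite phi q))
    (b : over v' w' (composite phi p') (composite phi q')) : Prop :=
  exists (ev : v = v') (ew : w = w') (ep : p = p') (eq : q = q'),
    over_cast ev ew (over_post (composite_eq phi eq) a)
    = over_pre b (composite_eq phi ep).

Lemma same_over_dbl (B : bicategory) (phi : composite_choice B)
  (P Q P' Q' : marked_path B) (h h' : dbl_hor P Q) (k k' : dbl_hor P' Q')
  (v v' : dbl_ver P P') (w w' : dbl_ver Q Q')
  (a : dbl_cell phi h k v w) (b : dbl_cell phi h' k' v' w') :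
  same_over a b -> @same_cell (dbl_data phi) P Q P' Q' h k v w a h' k' v' w' b.
Proof.
case=> ev [ew [ep [eq]]].
have eh : h = h' by apply: proof_irrelevance.
have ek : k = k' by apply: proof_irrelevance.
case: h' / eh b ep => b ep; case: k' / ek b eq => b eq.
case: v' / ev b => b; case: w' / ew b => b.
rewrite !composite_eq_id /over_post /over_pre /= comp2_idl => ->.
suff -> : cast2 v w (id2 (composite phi (dbl_seg h))) = id2 _.
  by rewrite comp2_idr.
by case: _ / v {a b}; case: _ / w.
Qed.

Lemma over_vcomp_idr (B : bicategory) (phi : composite_choice B)
  (X X' Y Y' : B) (v : X = X') (w : Y = Y') (p : bipath X Y) (q : bipath X' Y')
  (a : over v w (composite phi p) (composite phi q)) :
  same_over (over_vcomp a
    (id2 (composite phi p) : over erefl erefl (composite phi p) _)) a.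
Proof.
destruct v, w.
exists erefl, erefl, erefl, erefl.
by rewrite /over_post /over_pre /= comp2_idl.
Qed.

Lemma over_vcompA (B : bicategory) (phi : composite_choice B)
  (X0 X1 X2 X3 Y0 Y1 Y2 Y3 : B)
  (v1 : X0 = X1) (v2 : X1 = X2) (v3 : X2 = X3)
  (w1 : Y0 = Y1) (w2 : Y1 = Y2) (w3 : Y2 = Y3)
  (p0 : bipath X0 Y0) (p1 : bipath X1 Y1) (p2 : bipath X2 Y2) (p3 : bipath X3 Y3)
  (c : over v3 w3 (composite phi p2) (composite phi p3))
  (b : over v2 w2 (composite phi p1) (composite phi p2))
  (a : over v1 w1 (composite phi p0) (composite phi p1)) :
  same_over (over_vcomp c (over_vcomp b a)) (over_vcomp (over_vcomp c b) a).
Proof.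
destruct v3, w3, v2, w2, v1, w1.
exists erefl, erefl, erefl, erefl; rewrite /over_post /over_pre /= comp2_idl.
by rewrite comp2_idr comp2A.
Qed.

Definition composite_hid (B : bicategory) (phi : composite_choice B)
    (X X' : B) (v : X = X') (r : bipath X X) (e : r = pnil X)
    (s : bipath X' X') (e' : s = pnil X') :
    over v v (composite phi r) (composite phi s) :=
  over_post (bwd (composite_eq phi e'))
    (over_pre (over_id1 v) (composite_eq phi e)).

Lemma composite_hcomp_idl (B : bicategory) (phi : composite_choice B)
  (X X' Y Y' : B) (v : X = X') (w : Y = Y') (p : bipath X Y) (q : bipath X' Y')
  (r : bipath Y Y) (er : r = pnil Y) (s : bipath Y' Y') (es : s = pnil Y')
  (pr : bipath X Y) (epr : pr = pcat p r) (qs : bipath X' Y') (eqs : qs = pcat q s)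
  (a : over v w (composite phi p) (composite phi q)) :
  same_over (composite_hcomp epr eqs (composite_hid phi w er es) a) a.
Proof.
destruct v, w; subst r s pr qs; exists erefl, erefl, (pcat0 p), (pcat0 q).
have := composite_catp0 phi (pcat0 p); have := composite_catp0 phi (pcat0 q).
rewrite /composite_hcomp /composite_hid /over_post /over_pre.
move: (composite_cat phi p (pnil Y)) (composite_cat phi q (pnil Y)).
move: (composite_eq phi (pcat0 p)) (composite_eq phi (pcat0 q)).
move=> /= E F J K HF HE.
rewrite !comp2_idl !comp2_idr !comp2A HF.
have -> : fwd E = comp2 (lunit (composite phi p)) (bwd J).
  by rewrite -HE -comp2A bwdK comp2_idr.
by rewrite comp2A lunit_nat.
Qed.

Lemma composite_hcomp_idr (B : bicategory) (phi : composite_choice B)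
  (X X' Y Y' : B) (v : X = X') (w : Y = Y') (p : bipath X Y) (q : bipath X' Y')
  (r : bipath X X) (er : r = pnil X) (s : bipath X' X') (es : s = pnil X')
  (rp : bipath X Y) (erp : rp = pcat r p) (sq : bipath X' Y') (esq : sq = pcat s q)
  (a : over v w (composite phi p) (composite phi q)) :
  same_over (composite_hcomp erp esq a (composite_hid phi v er es)) a.
Proof.
destruct v, w; subst r s rp sq; exists erefl, erefl, erefl, erefl.
have := composite_cat0p phi p; have := composite_cat0p phi q.
rewrite /composite_hcomp /composite_hid /over_post /over_pre.
move: (composite_cat phi (pnil X) p) (composite_cat phi (pnil X) q).
move=> /= J K -> HJ.
rewrite !comp2_idl !comp2_idr !comp2A runit_nat -HJ.
by rewrite -comp2A bwdK comp2_idr.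
Qed.

Lemma composite_hcompA (B : bicategory) (phi : composite_choice B)
  (X0 X1 X2 X3 Y0 Y1 Y2 Y3 : B)
  (v0 : X0 = Y0) (v1 : X1 = Y1) (v2 : X2 = Y2) (v3 : X3 = Y3)
  (p1 : bipath X0 X1) (p2 : bipath X1 X2) (p3 : bipath X2 X3)
  (q1 : bipath Y0 Y1) (q2 : bipath Y1 Y2) (q3 : bipath Y2 Y3)
  (p12 : bipath X0 X2) (ep12 : p12 = pcat p1 p2)
  (p23 : bipath X1 X3) (ep23 : p23 = pcat p2 p3)
  (q12 : bipath Y0 Y2) (eq12 : q12 = pcat q1 q2)
  (q23 : bipath Y1 Y3) (eq23 : q23 = pcat q2 q3)
  (p p' : bipath X0 X3) (ep : p = pcat p12 p3) (ep' : p' = pcat p1 p23)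
  (q q' : bipath Y0 Y3) (eq : q = pcat q12 q3) (eq' : q' = pcat q1 q23)
  (c : over v2 v3 (composite phi p3) (composite phi q3))
  (b : over v1 v2 (composite phi p2) (composite phi q2))
  (a : over v0 v1 (composite phi p1) (composite phi q1)) :
  same_over (composite_hcomp ep eq c (composite_hcomp ep12 eq12 b a))
            (composite_hcomp ep' eq' (composite_hcomp ep23 eq23 c b) a).
Proof.
destruct v0, v1, v2, v3; subst p q p' q' p12 p23 q12 q23.
exists erefl, erefl, (esym (pcatA _ _ _)), (esym (pcatA _ _ _)).
have := composite_catA phi (pcatA p1 p2 p3).
have := composite_catA phi (pcatA q1 q2 q3).
have esymE (Y Z : B) (r r' : bipath Y Z) (e : r = r') :
    fwd (composite_eq phi (esym e)) = bwd (composite_eq phi e).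
  by case: _ / e.
rewrite /composite_hcomp /over_post /over_pre !esymE.
move: (composite_eq phi (pcatA p1 p2 p3)) => E.
move: (composite_eq phi (pcatA q1 q2 q3)) => F.
move: (composite_cat phi p1 (pcat p2 p3)) (composite_cat phi p2 p3).
move: (composite_cat phi (pcat p1 p2) p3) (composite_cat phi p1 p2).
move: (composite_cat phi q1 (pcat q2 q3)) (composite_cat phi q2 q3).
move: (composite_cat phi (pcat q1 q2) q3) (composite_cat phi q1 q2).
move=> /= L1 L2 L3 L4 J1 J2 J3 J4 HL HJ.
rewrite !comp2_idl !comp2_idr.
apply: (iso2_cancelL (i := F)).
apply: (iso2_cancelR (i :=
  iso2_comp E (iso2_comp J3 (iso2_hcomp J4 (iso2_id _))))).
rewrite /= {1}HJ !comp2A bwdK comp2_idl -!comp2A.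
rewrite !(comp2A (bwd E)) fwdK comp2_idl !(comp2A (bwd J3)) fwdK comp2_idl.
rewrite !(comp2A (bwd J1)) fwdK comp2_idl -interchange2 comp2_idr.
rewrite !(comp2A (hcomp2 _ _)) -!interchange2 -!comp2A !fwdK !comp2_idr.
rewrite -{1}(comp2_idl c) -{2}(comp2_idl a) !interchange2 -comp2A -assoc_nat.
by rewrite !comp2A; congr comp2; rewrite -!comp2A HL.
Qed.

Lemma composite_hid_id (B : bicategory) (phi : composite_choice B) (X : B)
  (r : bipath X X) (e : r = pnil X) :
  composite_hid phi erefl e e = id2 (composite phi r).
Proof. by subst r; rewrite /composite_hid /over_post /over_pre /= !comp2_idl. Qed.

Lemma composite_hcomp_id (B : bicategory) (phi : composite_choice B)
  (X Y Z : B) (p : bipath X Y) (q : bipath Y Z) (r : bipath X Z)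
  (e : r = pcat p q) :
  @composite_hcomp B phi X Y Z X Y Z erefl erefl erefl p q r e p q r e
    (id2 _) (id2 _) = id2 (composite phi r).
Proof.
subst r; rewrite /composite_hcomp /over_post /over_pre.
move: (composite_cat phi p q) => /= J.
by rewrite hcomp2_id !comp2_idl comp2_idr bwdK.
Qed.

Lemma composite_hid_vcomp (B : bicategory) (phi : composite_choice B)
  (X Y Z : B) (v : X = Y) (w : Y = Z)
  (p : bipath X X) (ep : p = pnil X) (q : bipath Y Y) (eq : q = pnil Y)
  (r : bipath Z Z) (er : r = pnil Z) :
  composite_hid phi (etrans v w) ep er
  = over_vcomp (composite_hid phi w eq er) (composite_hid phi v ep eq).
Proof.
destruct v, w; subst p q r.
by rewrite /composite_hid /over_post /over_pre /= !comp2_idl.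
Qed.

Lemma composite_interchange (B : bicategory) (phi : composite_choice B)
  (X0 Y0 Z0 X1 Y1 Z1 X2 Y2 Z2 : B)
  (u1 : X0 = X1) (v1 : Y0 = Y1) (w1 : Z0 = Z1)
  (u2 : X1 = X2) (v2 : Y1 = Y2) (w2 : Z1 = Z2)
  (p0 : bipath X0 Y0) (q0 : bipath Y0 Z0) (r0 : bipath X0 Z0) (e0 : r0 = pcat p0 q0)
  (p1 : bipath X1 Y1) (q1 : bipath Y1 Z1) (r1 : bipath X1 Z1) (e1 : r1 = pcat p1 q1)
  (p2 : bipath X2 Y2) (q2 : bipath Y2 Z2) (r2 : bipath X2 Z2) (e2 : r2 = pcat p2 q2)
  (d : over v2 w2 (composite phi q1) (composite phi q2))
  (c : over u2 v2 (composite phi p1) (composite phi p2))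
  (b : over v1 w1 (composite phi q0) (composite phi q1))
  (a : over u1 v1 (composite phi p0) (composite phi p1)) :
  over_vcomp (composite_hcomp e1 e2 d c) (composite_hcomp e0 e1 b a)
  = composite_hcomp e0 e2 (over_vcomp d b) (over_vcomp c a).
Proof.
destruct u1, v1, w1, u2, v2, w2; subst r0 r1 r2.
rewrite /composite_hcomp /over_post /over_pre.
move: (composite_cat phi p0 q0) (composite_cat phi p1 q1).
move: (composite_cat phi p2 q2) => /= L J K.
rewrite !comp2_idl !comp2_idr -!comp2A !(comp2A (bwd K)) fwdK comp2_idl.
by rewrite interchange2 -!comp2A.
Qed.

Lemma dbl_laws (B : bicategory) (phi : composite_choice B) :
  double_laws (dbl_data phi).
Proof.
split.
- by move=> P Q f; apply: (proof_irrelevance (dbl_hor P Q)).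
- by move=> P Q f; apply: (proof_irrelevance (dbl_hor P Q)).
- by move=> P Q R S h g f; apply: (proof_irrelevance (dbl_hor P S)).
- by move=> P Q v; apply: (proof_irrelevance (dbl_ver P Q)).
- by move=> P Q v; apply: (proof_irrelevance (dbl_ver P Q)).
- by move=> P Q R S x w v; apply: (proof_irrelevance (dbl_ver P S)).
- move=> A C A' C' f g v w a /=; rewrite comp2_idl.
  exact: (@same_cell_refl (dbl_data phi)).
- by move=> A C A' C' f g v w a; apply: same_over_dbl (over_vcomp_idr a).
- by move=> *; apply: same_over_dbl; apply: over_vcompA.
- by move=> *; apply: same_over_dbl; apply: composite_hcomp_idl.
- by move=> *; apply: same_over_dbl; apply: composite_hcomp_idr.
- by move=> *; apply: same_over_dbl; apply: composite_hcompA.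
- by move=> P; apply: esym (composite_hid_id phi (dbl_seg_id P)).
- by move=> *; apply: esym; apply: composite_hcomp_id.
- by move=> *; apply: composite_hid_vcomp.
- by move=> *; apply: composite_interchange.
Qed.

Definition Dbl (B : bicategory) (phi : composite_choice B) : double_category :=
  DoubleCategory (dbl_laws phi).

(* Main.v *)
Require Import Defs.
From mathcomp Require Import all_boot.
From Stdlib Require Import ProofIrrelevance.

Set Implicit Arguments.
Unset Strict Implicit.
Unset Printing Implicit Defensive.

(* A cell from an identity to f and a cell from f to an identity compose
   horizontally, up to unitors, to their vertical composite in the opposite order.
   So the companion equations say that the two binding cells are inverse to each
   other: a marked path is a companion iff its marked objects coincide and its
   chosen composite is isomorphic to the identity.  Hence being a left (right)
   precompanion amounts to the chosen composite having a left (right) inverse up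
   to isomorphism, and an arrow with both is an equivalence.  Conversely, the
   inverse of an equivalence becomes available as a horizontal arrow after
   replacing the path by a two-step path through that inverse. *)

(** * Equivalences and unit cells in a bicategory *)

Lemma equivalence_of_inverses (B : bicategory) (X Y : B) (f : hom X Y)
  (r l : hom Y X) :
  iso2 (comp1 r f) (id1 X) -> iso2 (comp1 f l) (id1 Y) -> is_equivalence f.
Proof.
move=> rf fl.
(* The classical chain [r] ≅ [r (f l)] ≅ [(r f) l] ≅ [l], built from its last link backwards. *)
have rl : iso2 r l.
  apply: (iso2_comp (lunit_iso l)).
  apply: (iso2_comp (iso2_hcomp rf (iso2_id l))).
  apply: (iso2_comp (iso2_inv (assoc_iso r f l))).
  exact: (iso2_comp (iso2_hcomp (iso2_id r) (iso2_inv fl))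
            (iso2_inv (runit_iso r))).
have fr : iso2 (comp1 f r) (id1 Y).
  exact: (iso2_comp fl (iso2_hcomp (iso2_id f) rl)).
exists r, (bwd rf), fr; split.
  by exists rf; split; [apply: bwdK | apply: fwdK].
by exists (bwd fr); split; [apply: fwdK | apply: bwdK].
Qed.

Lemma equivalence_inverse (B : bicategory) (X Y : B) (f : hom X Y) :
  is_equivalence f -> exists g : hom Y X,
    inhabited (iso2 (comp1 g f) (id1 X)) /\
    inhabited (iso2 (comp1 f g) (id1 Y)).
Proof.
move=> [g [eta [eps [[eta' [etaK etaVK]] [eps' [epsK epsVK]]]]]].
exists g; split; constructor; first exact: (Iso2 etaVK etaK).
exact: (Iso2 epsK epsVK).
Qed.

(* The middle-four exchange slides [psi] past [chi]; since the left and right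
   unitors of an identity 1-cell agree, horizontal composition of cells from and
   to an identity is their vertical composition in the opposite order. *)
Lemma hcomp2_unit_cells (B : bicategory) (X : B) (f : hom X X)
  (psi : cell2 (id1 X) f) (chi : cell2 f (id1 X)) :
  comp2 (lunit f) (hcomp2 chi psi) = comp2 (comp2 psi chi) (runit f).
Proof.
rewrite -{1}(comp2_idl chi) -{1}(comp2_idr psi) interchange2 comp2A lunit_nat.
by rewrite lunit_runit -!comp2A runit_nat.
Qed.

(** * Companions as invertible 2-cells *)

(** The segment of a horizontal identity equals the empty path without being convertible to it, so
    the paths enter as variables whose equations can be substituted away. *)
Lemma composite_hcomp_unit (B : bicategory) (phi : composite_choice B)
  (X : B) (p : bipath X X) (r : bipath X X) (er : r = pnil X)
  (s : bipath X X) (es : s = pnil X) (rp : bipath X X) (erp : rp = pcat r p)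
  (ps : bipath X X) (eps : ps = pcat p s)
  (psi : cell2 (composite phi r) (composite phi p))
  (chi : cell2 (composite phi p) (composite phi s)) :
  @same_over B phi X X X X erefl erefl erefl erefl rp p ps p
    (@composite_hcomp B phi X X X X X X erefl erefl erefl r p rp erp p s ps eps
      chi psi) (id2 (composite phi p))
  <-> comp2 psi (comp2 (bwd (composite_eq phi er))
        (comp2 (composite_eq phi es) chi)) = id2 (composite phi p).
Proof.
subst r s rp ps; rewrite /= !comp2_idl.
(* Concatenation with the empty path has the unitors as its coherence isomorphisms, so
   [hcomp2_unit_cells] applies. *)
have main : comp2 (composite_eq phi (pcat0 p))
    (@composite_hcomp B phi X X X X X X erefl erefl erefl (pnil X) p _ erefl
       p (pnil X) _ erefl chi psi) = comp2 psi chi.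
  move: (composite_catp0 phi (pcat0 p)) (composite_cat0p phi p).
  rewrite /composite_hcomp /over_post /over_pre.
  move: (composite_cat phi (pnil X) p) (composite_cat phi p (pnil X)).
  move: (composite_eq phi (pcat0 p)) => E J K /= HE HJ.
  rewrite !comp2_idl !comp2_idr; apply: (iso2_cancelR (i := J)).
  by rewrite -!comp2A fwdK comp2_idr !comp2A HE hcomp2_unit_cells HJ.
split.
- move=> [ev [ew [ep [eq]]]].
  rewrite (proof_irrelevance _ ev erefl) (proof_irrelevance _ ew erefl) /=.
  rewrite (proof_irrelevance _ ep erefl) (proof_irrelevance _ eq (pcat0 p)).
  by rewrite /over_post /over_pre main /= comp2_idl.
- move=> e; exists erefl, erefl, erefl, (pcat0 p).
  by rewrite /over_post /over_pre /= main e comp2_idl.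
Qed.

(** Passing to [same_over] frees the equations from marked paths: a vertical arrow becomes an
    equality between arbitrary objects, which can be eliminated. *)
Lemma same_cellP (B : bicategory) (phi : composite_choice B)
  (P Q P' Q' : marked_path B) (h h' : dbl_hor P Q) (k k' : dbl_hor P' Q')
  (v v' : dbl_ver P P') (w w' : dbl_ver Q Q')
  (a : dbl_cell phi h k v w) (b : dbl_cell phi h' k' v' w') :
  @same_cell (dbl_data phi) P Q P' Q' h k v w a h' k' v' w' b <->
  same_over a b.
Proof.
split=> [|ab]; last exact: same_over_dbl.
case=> {h' k' v' w' b}; exists erefl, erefl, erefl, erefl.
rewrite /over_post /over_pre /= comp2_idl.
rewrite /dbl_cell /over in a *.
have -> : cast2 v w (id2 (composite phi (dbl_seg h))) = id2 _.
  by case: _ / v {a}; case: _ / w.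
by rewrite comp2_idr.
Qed.

Lemma over_vcomp_hid (B : bicategory) (phi : composite_choice B)
  (X : B) (p : bipath X X) (r : bipath X X) (er : r = pnil X)
  (s : bipath X X) (es : s = pnil X)
  (psi : cell2 (composite phi r) (composite phi p))
  (chi : cell2 (composite phi p) (composite phi s)) :
  @same_over B phi X X X X erefl erefl erefl erefl r r s s
    (comp2 chi psi) (composite_hid phi erefl er es)
  <-> comp2 (comp2 (composite_eq phi es) chi)
        (comp2 psi (bwd (composite_eq phi er))) = id2 (id1 X).
Proof.
subst r s; rewrite /composite_hid /over_post /over_pre /= !comp2_idl comp2_idr.
split=> [[ev [ew [ep [eq]]]]|e].
  rewrite (proof_irrelevance _ ev erefl) (proof_irrelevance _ ew erefl).
  rewrite (proof_irrelevance _ ep erefl) (proof_irrelevance _ eq erefl).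
  by rewrite /over_post /over_pre /= !comp2_idl.
exists erefl, erefl, erefl, erefl.
by rewrite /over_post /over_pre /= e.
Qed.

(** The vertical arrow [v] is an equality of objects, so the identity is transported along it to
    become parallel to the composite. Once [v] is eliminated, the two companion equations are the
    two inverse laws, up to the identifications [er] and [es]. *)
Lemma over_companion (B : bicategory) (phi : composite_choice B)
  (X Y : B) (v : X = Y) (p : bipath X Y) (r : bipath X X) (er : r = pnil X)
  (s : bipath Y Y) (es : s = pnil Y) (rp : bipath X Y) (erp : rp = pcat r p)
  (ps : bipath X Y) (eps : ps = pcat p s) :
  (exists (psi : Defs.over erefl v (composite phi r) (composite phi p))
          (chi : Defs.over v erefl (composite phi p) (composite phi s)),
     same_over (composite_hcomp erp eps chi psi)
       (id2 (composite phi p) : Defs.over erefl erefl (composite phi p) _) /\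
     same_over (over_vcomp chi psi) (composite_hid phi v er es))
  <-> inhabited (iso2 (cast1 erefl v (id1 X)) (composite phi p)).
Proof.
destruct v; split.
- move=> [psi [chi [/composite_hcomp_unit Hh /over_vcomp_hid Hv]]].
  constructor; apply: (Iso2 (fwd := comp2 psi (bwd (composite_eq phi er)))
    (bwd := comp2 (composite_eq phi es) chi)) => //.
  by rewrite -comp2A.
- move=> [i]; exists (comp2 i (composite_eq phi er)).
  exists (comp2 (bwd (composite_eq phi es)) (bwd i)).
  split; [apply/(composite_hcomp_unit er es) | apply/over_vcomp_hid].
    rewrite !comp2A -(comp2A i) bwdK comp2_idr -(comp2A i) bwdK comp2_idr.
    exact: bwdK.
  by rewrite -!(comp2A i) bwdK comp2_idr comp2A bwdK comp2_idl fwdK.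
Qed.

Lemma companionP (B : bicategory) (phi : composite_choice B)
  (P Q : marked_path B) (h : dbl_hor P Q) :
  @is_companion (Dbl phi) P Q h <->
  exists v : mark P = mark Q,
    inhabited (iso2 (cast1 erefl v (id1 (mark P))) (composite phi (dbl_seg h))).
Proof.
have over_h (v : mark P = mark Q) :=
  over_companion phi v (dbl_seg_id P) (dbl_seg_id Q)
    (dbl_seg_cat h (dbl_hid P)) (dbl_seg_cat (dbl_hid Q) h).
split=> [[v [psi [chi [/same_cellP Hh /same_cellP Hv]]]]|[v i]]; exists v.
  by apply: (proj1 (over_h v)); exists psi, chi.
have [psi [chi [Hh Hv]]] := proj2 (over_h v) i.
by exists psi, chi; split; apply: same_over_dbl.
Qed.

(** * Vertically invertible double cells *)

Lemma over_invertible (B : bicategory) (phi : composite_choice B)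
  (X Y X' Y' : B) (v : X = X') (w : Y = Y') (v' : X' = X) (w' : Y' = Y)
  (p : bipath X Y) (q : bipath X' Y')
  (a : Defs.over v w (composite phi p) (composite phi q))
  (b : Defs.over v' w' (composite phi q) (composite phi p)) :
  same_over (over_vcomp b a)
    (id2 (composite phi p) : Defs.over erefl erefl (composite phi p) _) ->
  same_over (over_vcomp a b)
    (id2 (composite phi q) : Defs.over erefl erefl (composite phi q) _) ->
  inhabited (iso2 (cast1 v w (composite phi p)) (composite phi q)).
Proof.
(* After elimination of [v] and [w], the arrows [v'] and [w'] are loops, hence reflexivity. *)
destruct v, w; move: b; rewrite (proof_irrelevance _ v' erefl).
rewrite (proof_irrelevance _ w' erefl) => b.
have id_over (s : bipath X Y) (c : cell2 (composite phi s) (composite phi s)) :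
    @same_over B phi X X Y Y erefl erefl erefl erefl s s s s
      c (id2 (composite phi s)) -> c = id2 _.
  move=> [ev [ew [ep [eq]]]].
  rewrite (proof_irrelevance _ ev erefl) (proof_irrelevance _ ew erefl).
  rewrite (proof_irrelevance _ ep erefl) (proof_irrelevance _ eq erefl).
  by rewrite /over_post /over_pre /= !comp2_idl.
by move=> /id_over ba /id_over ab; constructor; exact: (Iso2 ba ab).
Qed.

Lemma vinvertible_iso (B : bicategory) (phi : composite_choice B)
  (P Q P' Q' : marked_path B) (h : dbl_hor P Q) (k : dbl_hor P' Q')
  (v : dbl_ver P P') (w : dbl_ver Q Q') (a : dbl_cell phi h k v w) :
  @vinvertible (Dbl phi) P Q P' Q' h k v w a ->
  inhabited (iso2 (cast1 v w (composite phi (dbl_seg h)))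
               (composite phi (dbl_seg k))).
Proof.
move=> [v' [w' [b [/same_cellP ba /same_cellP ab]]]].
exact: over_invertible ba ab.
Qed.

Lemma iso_vinvertible (B : bicategory) (phi : composite_choice B)
  (P Q P' Q' : marked_path B) (h : dbl_hor P Q) (k : dbl_hor P' Q')
  (v : dbl_ver P P') (w : dbl_ver Q Q')
  (i : iso2 (cast1 v w (composite phi (dbl_seg h))) (composite phi (dbl_seg k))) :
  @vinvertible (Dbl phi) P Q P' Q' h k v w (fwd i).
Proof.
suff [b [ba ab]] : exists b : Defs.over (esym v) (esym w) (composite phi (dbl_seg k))
      (composite phi (dbl_seg h)),
    same_over (over_vcomp b (fwd i))
      (id2 (composite phi (dbl_seg h)) : Defs.over erefl erefl (composite phi _) _) /\
    same_over (over_vcomp (fwd i : Defs.over v w _ _) b)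
      (id2 (composite phi (dbl_seg k)) : Defs.over erefl erefl (composite phi _) _).
  by exists (esym v), (esym w), b; split; apply: same_over_dbl.
rewrite /dbl_ver in v w i *.
(* The segments are generalized because their types mention the marked objects that [v] and [w]
   identify. *)
move: (dbl_seg h) (dbl_seg k) i => p q; destruct v, w => i.
exists (bwd i); split; exists erefl, erefl, erefl, erefl.
  by rewrite /over_post /over_pre /= fwdK.
by rewrite /over_post /over_pre /= bwdK.
Qed.

(** * Precompanions as one-sided inverses *)

Lemma composite_dbl_hcomp (B : bicategory) (phi : composite_choice B)
  (P Q R : marked_path B) (k : dbl_hor Q R) (h : dbl_hor P Q) :
  iso2 (composite phi (dbl_seg (dbl_hcomp k h)))
       (comp1 (composite phi (dbl_seg k)) (composite phi (dbl_seg h))).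
Proof.
exact: (iso2_comp (iso2_inv (composite_cat phi _ _))
  (composite_eq phi (dbl_seg_cat k h))).
Qed.

Lemma left_inverse_cast (B : bicategory) (X Y X' Y' Z : B)
  (v : X = X') (w : Y = Y') (u : X' = Z)
  (f : hom X Y) (f' : hom X' Y') (r : hom Y' Z) :
  iso2 (cast1 v w f) f' -> iso2 (cast1 erefl u (id1 X')) (comp1 r f') ->
  exists r' : hom Y X, inhabited (iso2 (comp1 r' f) (id1 X)).
Proof.
destruct v, w, u => /= i j; exists r; constructor.
exact: (iso2_comp (iso2_inv j) (iso2_hcomp (iso2_id r) i)).
Qed.

Lemma right_inverse_cast (B : bicategory) (X Y X' Y' Z : B)
  (v : X = X') (w : Y = Y') (u : Z = Y')
  (f : hom X Y) (f' : hom X' Y') (l : hom Z X') :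
  iso2 (cast1 v w f) f' -> iso2 (cast1 erefl u (id1 Z)) (comp1 f' l) ->
  exists l' : hom Y X, inhabited (iso2 (comp1 f l') (id1 Y)).
Proof.
destruct v, w; destruct u => /= i j; exists l; constructor.
exact: (iso2_comp (iso2_inv j) (iso2_hcomp i (iso2_id l))).
Qed.

(** The chosen bracketing is an abstract term even for one arrow, so the comparison goes through
    [norm], which is [f] followed by an identity. *)
Lemma composite_single (B : bicategory) (phi : composite_choice B) (X Y : B)
  (f : hom X Y) : iso2 (composite phi (pcons f (pnil Y))) f.
Proof. exact: (iso2_comp (lunit_iso f) (composite_norm phi (pcons f (pnil Y)))). Qed.

Lemma left_precompanionP (B : bicategory) (phi : composite_choice B)
  (P Q : marked_path B) (h : dbl_hor P Q) :
  @left_precompanion (Dbl phi) P Q h <->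
  exists r : hom (mark Q) (mark P),
    inhabited (iso2 (comp1 r (composite phi (dbl_seg h))) (id1 (mark P))).
Proof.
set F := composite phi (dbl_seg h); split.
  move=> [A' [B' [C [f' [r [v [w [a [/vinvertible_iso [i]]]]]]]]]].
  case/companionP=> u [j].
  exact: (left_inverse_cast i (iso2_comp (composite_dbl_hcomp phi r f') j)).
move=> [r [i]].
(* The arrow [r] need not occur on the path of [h]. On this path it does, and the vertices 0, 1, 2
   are [mark P], [mark Q], [mark P] by computation, so every vertical arrow below is reflexivity. *)
pose p := pcons F (pcons r (pnil (mark P))).
pose m k := @marked B _ _ p k.
pose i0 : 'I_3 := @Ordinal 3 0 isT; pose i1 : 'I_3 := @Ordinal 3 1 isT.
pose i2 : 'I_3 := @Ordinal 3 2 isT.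
pose f' : dbl_hor (m i0) (m i1) := @dbl_arrow B _ _ p i0 i1 isT.
pose r' : dbl_hor (m i1) (m i2) := @dbl_arrow B _ _ p i1 i2 isT.
have j : iso2 (cast1 erefl erefl F) (composite phi (dbl_seg f')).
  exact: (iso2_inv (composite_single phi F)).
exists (m i0), (m i1), (m i2), f', r', erefl, erefl, (fwd j).
split; first exact: (@iso_vinvertible B phi P Q (m i0) (m i1) h f' erefl erefl j).
apply/companionP; exists erefl; constructor.
apply: (iso2_comp (iso2_inv (composite_dbl_hcomp phi r' f'))).
exact: (iso2_comp (iso2_inv (iso2_hcomp (composite_single phi r)
  (composite_single phi F))) (iso2_inv i)).
Qed.

Lemma right_precompanionP (B : bicategory) (phi : composite_choice B)
  (P Q : marked_path B) (h : dbl_hor P Q) :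
  @right_precompanion (Dbl phi) P Q h <->
  exists l : hom (mark Q) (mark P),
    inhabited (iso2 (comp1 (composite phi (dbl_seg h)) l) (id1 (mark Q))).
Proof.
set F := composite phi (dbl_seg h); split.
  move=> [A' [B' [C [f' [l [v [w [a [/vinvertible_iso [i]]]]]]]]]].
  case/companionP=> u [j].
  exact: (right_inverse_cast i (iso2_comp (composite_dbl_hcomp phi f' l) j)).
move=> [l [i]].
(* Dually, the inverse now precedes [F], which therefore runs from index 1 to index 2. *)
pose p := pcons l (pcons F (pnil (mark Q))).
pose m k := @marked B _ _ p k.
pose i0 : 'I_3 := @Ordinal 3 0 isT; pose i1 : 'I_3 := @Ordinal 3 1 isT.
pose i2 : 'I_3 := @Ordinal 3 2 isT.
pose l' : dbl_hor (m i0) (m i1) := @dbl_arrow B _ _ p i0 i1 isT.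
pose f' : dbl_hor (m i1) (m i2) := @dbl_arrow B _ _ p i1 i2 isT.
have j : iso2 (cast1 erefl erefl F) (composite phi (dbl_seg f')).
  exact: (iso2_inv (composite_single phi F)).
exists (m i1), (m i2), (m i0), f', l', erefl, erefl, (fwd j).
split; first exact: (@iso_vinvertible B phi P Q (m i1) (m i2) h f' erefl erefl j).
apply/companionP; exists erefl; constructor.
apply: (iso2_comp (iso2_inv (composite_dbl_hcomp phi f' l'))).
exact: (iso2_comp (iso2_inv (iso2_hcomp (composite_single phi F)
  (composite_single phi l))) (iso2_inv i)).
Qed.

Theorem proposition3p16 (B : bicategory) (phi : composite_choice B)
    (A0 An : B) (f : bipath A0 An) (i0 i1 : 'I_(plen f).+1)
    (h : i0 <= i1) :
  @precompanion (Dbl phi) (marked f i0) (marked f i1) (dbl_arrow h)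
  <-> is_equivalence (composite phi (seg f h)).
Proof.
split.
  (* The path equality inside [dbl_arrow h] is reflexivity, so its [dbl_seg] computes to
     [seg f h]. *)
  move=> [/left_precompanionP [r [rf]] /right_precompanionP [l [fl]]].
  exact: equivalence_of_inverses rf fl.
move=> /equivalence_inverse [g [gf fg]].
by split; [apply/left_precompanionP | apply/right_precompanionP]; exists g.
Qed.
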